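(* Let $d$ be an integer with $0\leq d<\infty$, and let $$c=\begin{cases}0 & \text{if } d\leq 1,\\ 2 & \text{if } 2\leq d\leq 3,\\ \lceil d/2\rceil+1 & \text{if } d\geq 4.\end{cases}$$ Let $X$ be a normal space of covering dimension $d$. Let $n\geq 1$ be an integer, let $f:X\to M_n$ be continuous and let $\epsilon:X\to\mathbb{R}_{>0}$ be continuous. Then there exist continuous maps $g:X\to M_n$ and $u:X\to U_n$ such that for all $x\in X$: (1) $g(x)-f(x)$ is self-adjoint; (2) $\|f(x)-g(x)\|<\epsilon(x)$; (3) the matrix $u(x)g(x)u(x)^*$ belongs to $H_n^{n-c}$.
   Context: $M_n$ is the set of complex $n\times n$ matrices with the operator norm, $U_n\subset M_n$ the set of unitary matrices, $\mathbb{R}_{>0}$ the positive reals, $\lceil t\rceil$ the smallest integer $\geq t$. A topological space is normal if any two disjoint closed subsets have disjoint neighborhoods (no Hausdorff assumption). Covering dimension: a space $X$ has dimension at most $d$ if every open covering of $X$ has an open refinement $(V_j)_{j\in J}$ such that each $x\in X$ lies in $V_j$ for at most $d+1$ indices $j$; $\dim X$ is the smallest such $d\in\{0,1,2,\dots\}$ (or $\infty$ if none exists). For $n\geq1$ and $k\in\{0,\dots,n\}$, $H_n^k$ is the set of matrices $m=(m_{ij})\in M_n$ ($i$ = row, $j$ = column) such that $m_{ij}=0$ whenever $j\leq k$ and $i\geq j+2$, and $m_{ij}\in\mathbb{R}_{>0}$ whenever $j\leq k$ and $i=j+1$ (with $1\le i,j\le n$). Thus $H_n^0=M_n$ and $H_n^{n-1}=H_n^n$.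 For $k<0$ the conditions are vacuous and $H_n^k=M_n$. *)

(* Defs.v *)
From HB Require Import structures.
From mathcomp Require Import all_boot all_order all_algebra.
From mathcomp Require Import all_classical all_reals all_analysis.
From mathcomp Require Import complex.

Set Implicit Arguments.
Unset Strict Implicit.
Unset Printing Implicit Defensive.

Import Order.TTheory GRing.Theory Num.Theory.
Import numFieldNormedType.Exports.

Local Open Scope classical_set_scope.
Local Open Scope card_scope.
Local Open Scope ring_scope.
Local Open Scope complex_scope.

(* R[i] carries the topology of its modulus, so that 'M[R[i]]_n carries the
   entrywise topology, which is also the operator norm topology. *)
HB.instance Definition _ (R : rcfType) := NormedModule.copy R[i] R[i]^o.

(* An empty space has covering dimension 0. *)
Definition covering_dim_le (X : topologicalType) (d : nat) : Prop :=
  forall (I : Type) (U : I -> set X),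
    (forall i, open (U i)) -> \bigcup_i U i = [set: X] ->
    exists (J : Type) (V : J -> set X),
      [/\ forall j, open (V j), \bigcup_j V j = [set: X],
          forall j, exists i, V j `<=` U i
        & forall x : X, [set j | V j x] #<= `I_d.+1].

Definition covering_dim_eq (X : topologicalType) (d : nat) : Prop :=
  covering_dim_le X d /\ forall e : nat, covering_dim_le X e -> (d <= e)%N.

Definition l2norm {R : rcfType} {n : nat} (v : 'cV[R[i]]_n) : R :=
  Num.sqrt (\sum_(i < n) ComplexField.Normc.normc (v i 0) ^+ 2).

Definition opnorm {R : realType} {n : nat} (A : 'M[R[i]]_n) : R :=
  sup [set l2norm (A *m v) | v in [set v : 'cV[R[i]]_n | l2norm v <= 1]].

(* Indices in 'I_n start at 0: column number j + 1 is <= k iff j < k. The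
   parameter k is an integer, so that the condition is vacuous for k < 0. Note
   that 0 < z in R[i] means that z is real and positive. *)
Definition Hmx (R : rcfType) (n : nat) (k : int) : set 'M[R[i]]_n :=
  [set m | forall i j : 'I_n, (j%:Z < k)%R ->
    ((j.+2 <= i)%N -> m i j = 0) /\ (i = j.+1 :> nat -> 0 < m i j)].

Definition codim_bound (d : nat) : nat :=
  if (d <= 1)%N then 0%N
  else if (d <= 3)%N then 2%N
  else (uphalf d).+1. (* uphalf d is the ceiling of d / 2 *)

(* Main.v *)
(* Columns are put in Hessenberg form one after the other. If the first k
   columns of h = u g u^* are done, the part w of column k + 1 below the diagonal
   is a map to C^m with m = n - k - 1, and a small self-adjoint change of h, which
   leaves the first k columns alone, replaces w by any nearby w'. Since d < 2 m,
   w' can be chosen without zeros; since even d < 2 m - 1 except for m <= 2, it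
   can otherwise be kept off the real line through the first basis vector. In
   each case an explicit formula (a Householder reflection, or the group
   structure of the unit sphere of C or C^2) gives a unitary depending
   continuously on w' that sends w' to a positive multiple of that vector.
   A map b to R^N with N > d is made nowhere zero through the nerve of a fine
   finite cover of order at most N: the vertices are sent to points any N of
   which are linearly independent. *)

Require Import Defs.
From HB Require Import structures.
From mathcomp Require Import all_boot all_order all_algebra.
From mathcomp Require Import spectral sesquilinear.
From mathcomp Require Import all_classical all_reals all_analysis.
From mathcomp Require Import complex.
From mathcomp Require Import ring lra zify.

Set Implicit Arguments.
Unset Strict Implicit.
Unset Printing Implicit Defensive.

Import Order.TTheory GRing.Theory Num.Theory.
Import numFieldNormedType.Exports.

Local Open Scope classical_set_scope.
Local Open Scope ring_scope.
Local Open Scope sesquilinear_scope.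

(** * General position *)

(** The [size p] points [b / (k + 2)] are distinct and lie strictly between 0 and [b], while a
    nonzero polynomial has fewer than [size p] roots. *)
Lemma exists_small_nonroot (R : realFieldType) (p : {poly R}) (b : R) :
  p != 0 -> 0 < b -> exists t, [/\ 0 < t, t < b & p.[t] != 0].
Proof.
move=> p0 b0; pose s := [seq b / k.+2%:R | k <- iota 0 (size p)].
have Us : uniq s.
  rewrite map_inj_uniq ?iota_uniq// => k l /(mulfI (lt0r_neq0 b0)) /invr_inj.
  by move/eqP; rewrite eqr_nat => /eqP [].
have [rs|] := boolP (all (root p) s).
  by have := max_poly_roots p0 rs Us; rewrite size_map size_iota ltnn.
case/allPn => _ /mapP[k _ ->] ptk; exists (b / k.+2%:R); split => //.
- by rewrite divr_gt0.
- by rewrite ltr_pdivrMr ?ltr0n// ltr_pMr// ltr1n.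
Qed.

(* Moving each point along its own point of the moment curve works: the
   determinants then are nonzero polynomials in the size of the move. *)
Lemma general_position (R : realFieldType) (I : finType) (N : nat)
    (q : I -> 'rV[R]_N) (e : R) : 0 < e ->
  exists p : I -> 'rV[R]_N,
    (forall i k, `|p i 0 k - q i 0 k| < e) /\
    (forall s : 'I_N -> I, injective s ->
       \matrix_(k < N) p (s k) \in unitmx).
Proof.
move=> e0; pose a (i : I) : R := (enum_rank i)%:R.
have a_inj : injective a.
  move=> i j /eqP; rewrite eqr_nat => /eqP ij.
  by apply: enum_rank_inj; apply: val_inj.
(* The rows of [W s] are points of the moment curve with distinct parameters, so [W s] is a
   Vandermonde matrix up to transposition. *)
pose W (s : 'I_N -> I) : 'M[R]_N := \matrix_(k, l) a (s k) ^+ l.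
pose Q (s : 'I_N -> I) : 'M[R]_N := \matrix_k q (s k).
have W_unit s : injective s -> W s \in unitmx.
  move=> s_inj; rewrite -unitmx_tr unitmxE unitfE.
  have -> : (W s)^T = Vandermonde N (\row_k a (s k)).
    by apply/matrixP => k l; rewrite !mxE.
  rewrite det_Vandermonde; apply/prodf_neq0 => k _; apply/prodf_neq0 => l kl.
  rewrite !mxE subr_eq0; apply/eqP => /a_inj /s_inj lk.
  by rewrite lk ltnn in kl.
(* Since [Q + t W = W (t - (- W^-1 Q))], its determinant is [det W] times this monic polynomial at
   [t]. Noninjective [s] get 1, so that the product over all [s] is nonzero and one [t] serves every
   injective [s]. *)
pose pol (s : {ffun 'I_N -> I}) : {poly R} :=
  if injectiveb s then char_poly (- (invmx (W s) *m Q s)) else 1.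
have pol0 s : pol s != 0.
  rewrite /pol; case: ifP => _; last exact: oner_neq0.
  by rewrite monic_neq0// char_poly_monic.
(* [B] dominates every coordinate of the curve points in use, so [t < e / B] keeps each move below
   [e]. The summand 1 makes [B] positive even if [I] is empty. *)
pose B := 1 + \sum_i \sum_(k < N) `|a i ^+ k|.
have B0 : 0 < B.
  by rewrite ltr_wpDr// sumr_ge0// => i _; rewrite sumr_ge0.
have P0 : \prod_s pol s != 0 by exact/prodf_neq0.
have [t [t0 teB tP]] := exists_small_nonroot P0 (divr_gt0 e0 B0).
exists (fun i => q i + t *: \row_k (a i ^+ k)); split.
  move=> i k; rewrite !mxE addrAC subrr add0r normrM gtr0_norm//.
  apply: le_lt_trans (_ : t * B < e); last by rewrite -ltr_pdivlMr.
  rewrite ler_pM2l// /B (bigD1 i)//= (bigD1 k)//= ler_wpDl//.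
  rewrite -addrA ler_wpDr// addr_ge0//.
    by rewrite sumr_ge0.
  by rewrite sumr_ge0// => ? _; rewrite sumr_ge0.
move=> s s_inj.
have -> : \matrix_k (q (s k) + t *: \row_l (a (s k) ^+ l)) = Q s + t *: W s.
  by apply/matrixP => k l; rewrite !mxE.
have -> : Q s + t *: W s =
    W s *m (t%:M - (- (invmx (W s) *m Q s))).
  by rewrite opprK mulmxDr mulKVmx ?W_unit// mul_mx_scalar addrC.
rewrite unitmx_mul W_unit//= unitmxE unitfE.
move: tP; rewrite horner_prod => /prodf_neq0/(_ [ffun k => s k] isT).
have sE : ([ffun k => s k] : 'I_N -> I) = s by apply/funext => k; rewrite ffunE.
rewrite /pol sE ifT; last exact/injectiveP.
set A := - _; rewrite /char_poly -horner_evalE -det_map_mx.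
suff -> : map_mx (horner_eval t) (char_poly_mx A) = t%:M - A by [].
apply/matrixP => k l; rewrite !mxE /horner_eval.
by rewrite hornerD hornerN hornerMn hornerX hornerC.
Qed.

(** * Nowhere vanishing perturbations *)

Lemma continuous_sum (K : numFieldType) (X : topologicalType) (I : Type)
    (r : seq I) (P : pred I) (f : I -> X -> K) :
  (forall i, P i -> continuous (f i)) ->
  continuous (fun x => \sum_(i <- r | P i) f i x).
Proof.
move=> fc; elim: r => [|i r IH].
  rewrite (_ : (fun x => _) = fun=> 0); first exact: cst_continuous.
  by apply/funext => x; rewrite big_nil.
rewrite (_ : (fun x => _) = fun x =>
  if P i then f i x + \sum_(j <- r | P j) f j x
  else \sum_(j <- r | P j) f j x); last by apply/funext => x; rewrite big_cons.
case Pi : (P i) => // x.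
by apply: (@continuousD K K^o); [exact: fc|exact: IH].
Qed.

Lemma mx_continuousP (X T : topologicalType) (m n : nat)
    (f : X -> 'M[T]_(m, n)) :
  (forall i j, continuous (fun x => f x i j)) -> continuous f.
Proof.
move=> fc x A [P Pf PA]; apply: (filterS PA).
by apply: filter_forall => i; apply: filter_forall => j; exact: fc (Pf i j).
Qed.

Lemma mx_coord_continuous (X T : topologicalType) (m n : nat)
    (f : X -> 'M[T]_(m, n)) i j :
  continuous f -> continuous (fun x => f x i j).
Proof.
move=> fc x A fA; apply: (fc x [set M | A (M i j)]).
exists (fun k l => if (k == i) && (l == j) then A else setT).
  move=> k l; case: ifP => [/andP[/eqP -> /eqP ->] //|_]; exact: filterT.
by move=> M /(_ i j) /=; rewrite !eqxx.
Qed.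

(** The members of an arbitrary refinement are grouped by a chosen [U i] containing them. The order
    does not grow: distinct groups through [x] contain distinct members through [x]. *)
Lemma finite_refinement (X : topologicalType) (d : nat) (I : finType)
    (U : I -> set X) :
  covering_dim_le X d -> (forall i, open (U i)) -> \bigcup_i U i = setT ->
  exists V : I -> set X,
    [/\ forall i, open (V i), \bigcup_i V i = setT,
        forall i, V i `<=` U i
      & forall x (S : {set I}), (forall i, i \in S -> V i x) ->
          (#|S| <= d.+1)%N].
Proof.
move=> dimX Uo Uc; have [J [W [Wo Wc WU Wd]]] := dimX I U Uo Uc.
have [phi phiP] := choice WU.
exists (fun i => \bigcup_(j in [set j | phi j = i]) W j); split.
- by move=> i; apply: bigcup_open.
- rewrite -subTset => x _; have [j _ Wjx] : (\bigcup_j W j) x by rewrite Wc.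
  by exists (phi j) => //; exists j.
- by move=> i x [j /= <-]; exact: phiP.
move=> x S SV.
have jP (k : 'I_#|S|) : exists j, W j x /\ phi j = enum_val k.
  by have [j ? ?] := SV _ (enum_valP k); exists j.
have [h hP] := choice jP.
have /card_leP[f] := Wd x.
(* Each element of [S] is sent to a member [h k] through [x], then to its number under the injection
   given by the order bound. That number is below [d.+1], so [inord] never takes its default
   value. *)
pose g (k : 'I_#|S|) : 'I_d.+1 :=
  inord (\val (f (SigSub (mem_set (hP k).1 : h k \in [set j | W j x])))).
suff g_inj : injective g by have := leq_card g g_inj; rewrite !card_ord.
move=> k l /(congr1 val); rewrite /= !inordK; last 2 first.
- by case: (f _) => /= m; rewrite inE.
- by case: (f _) => /= m; rewrite inE.
move=> /val_inj /(inj (in_setT _) (in_setT _)) /(congr1 \val) /= hkl.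
by apply: enum_val_inj; rewrite -(hP k).2 hkl (hP l).2.
Qed.

(* Replacing the sets one after the other by cozero sets keeps a cover. *)
Lemma cozero_refinement (R : realType) (X : topologicalType) (I : finType)
    (U : I -> set X) :
  normal_space X -> (forall i, open (U i)) -> \bigcup_i U i = setT ->
  exists l : I -> X -> R,
    [/\ forall i, continuous (l i), forall i x, 0 <= l i x,
        forall i x, 0 < l i x -> U i x & forall x, exists i, 0 < l i x].
Proof.
move=> normalX Uo Uc.
suff [V [Vo Vc VU Vl]] : exists V : I -> set X,
    [/\ forall i, open (V i), \bigcup_i V i = setT, forall i, V i `<=` U i
      & forall i, i \in enum I -> exists l : X -> R,
          [/\ continuous l, forall x, 0 <= l x & V i = [set x | 0 < l x]]].
  have [l lP] := choice (fun i => Vl i (mem_enum I i)).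
  exists l; split.
  - by move=> i; have [] := lP i.
  - by move=> i; have [] := lP i.
  - by move=> i x l0; apply: VU; have [_ _ ->] := lP i.
  - move=> x; have [i _ Vix] : (\bigcup_i V i) x by rewrite Vc.
    by exists i; have [_ _ Vi] := lP i; rewrite Vi in Vix.
elim: (enum I) => [|i s [V [Vo Vc VU Vl]]]; first by exists U; split => // ?.
(* The two closed sets are disjoint because [V] covers. The function vanishes off [V i] and is 1
   where no other member covers, so its positivity set can replace [V i]. *)
have [|||f [fc f0 f1 f01]] := @urysohn_ext_itv X R normalX
    (~` V i) (~` \bigcup_(j in [set j | j <> i]) V j) 0 1 _ _ _ ltr01.
- exact: open_closedC.
- by apply/open_closedC/bigcup_open => j _; exact: Vo.
- rewrite -subset0 => x [/= nVi nVj].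
  have [j _ Vjx] : (\bigcup_i V i) x by rewrite Vc.
  have [ji|/eqP ji] := eqVneq j i; first by rewrite ji in Vjx; case: (nVi Vjx).
  by case: (nVj (ex_intro2 _ _ j ji Vjx)).
have f_ge0 x : 0 <= f x.
  have /= := f01 (f x) (ex_intro2 _ _ x Logic.I erefl).
  by rewrite in_itv/= => /andP[].
have fV x : 0 < f x -> V i x.
  move=> fx; apply: contrapT => nV; have := f0 (f x) (ex_intro2 _ _ x nV erefl).
  by move=> /= f00; rewrite f00 ltxx in fx.
exists (fun j => if j == i then [set x | 0 < f x] else V j); split.
- move=> j; case: ifP => _ //; apply: (open_comp _ (@open_gt R 0)).
  by move=> x _; exact: fc.
- rewrite -subTset => x _.
  have [[j /= ji Vj]|nV] := pselect ((\bigcup_(j in [set j | j <> i]) V j) x).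
    by exists j => //; case: eqP.
  exists i => //; rewrite eqxx /=.
  by have /= -> := f1 (f x) (ex_intro2 _ _ x nV erefl).
- by move=> j x; case: eqP => [-> /fV /VU|_ /VU].
- move=> j; rewrite inE => /orP[/eqP ->|js]; first by exists f; rewrite eqxx.
  by case: eqP => _; [exists f|exact: Vl].
Qed.

(** At most [N] coefficients are nonzero. The spare indices [inr k] pad their support to exactly [N]
    distinct indices, and a nonzero row times an invertible matrix is nonzero. *)
Lemma sum_points_neq0 (R : fieldType) (I : finType) (N : nat)
    (p : I + 'I_N -> 'rV[R]_N) (l : I -> R) :
  (forall s : 'I_N -> I + 'I_N, injective s ->
     \matrix_(k < N) p (s k) \in unitmx) ->
  (exists i, l i != 0) -> (#|[set i | l i != 0%R]%SET| <= N)%N ->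
  \sum_i l i *: p (inl i) != 0.
Proof.
move=> p_unit [i0 li0] SN; set S := [set i | l i != 0%R]%SET in SN.
pose s (k : 'I_N) : I + 'I_N :=
  if (k < #|S|)%N then inl (nth i0 (enum S) k) else inr k.
have s_inj : injective s.
  move=> k k'; rewrite /s; case: ifPn => kS; case: ifPn => kS' //; last by case.
  case=> /eqP; rewrite nth_uniq ?enum_uniq -?cardE// => /eqP ?.
  exact: val_inj.
pose L (t : I + 'I_N) : R := if t is inl i then l i else 0.
have Sidx : (index i0 (enum S) < #|S|)%N.
  by rewrite cardE index_mem mem_enum inE.
have sidx : s (Ordinal (leq_trans Sidx SN)) = inl i0.
  by rewrite /s Sidx nth_index// mem_enum inE.
have sumE : \sum_i l i *: p (inl i) =
    (\row_k L (s k)) *m (\matrix_(k < N) p (s k)).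
  transitivity (\sum_t L t *: p t).
    rewrite big_sumType/= [X in _ + X]big1 ?addr0// => k _.
    by rewrite scale0r.
  rewrite (bigID (mem (s @: 'I_N)%SET))/= [X in _ + X]big1 ?addr0 => [|t].
    rewrite big_imset/=; last by move=> ? ? _ _ /s_inj.
    apply/rowP => j; rewrite !mxE summxE; apply: eq_bigr => k _.
    by rewrite !mxE.
  case: t => [i|k _]; last by rewrite scale0r.
  move=> si; rewrite /L; have [->|li] := eqVneq (l i) 0; first by rewrite scale0r.
  case/imsetP: si.
  have iS : (index i (enum S) < #|S|)%N by rewrite cardE index_mem mem_enum inE.
  exists (Ordinal (leq_trans iS SN)) => //.
  by rewrite /s iS nth_index// mem_enum inE.
rewrite sumE; apply: contra li0 => /eqP eq0.
have /rowP/(_ (Ordinal (leq_trans Sidx SN))) : \row_k L (s k) = 0.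
  by rewrite -[LHS](mulmxK (p_unit s s_inj)) eq0 mul0mx.
by rewrite !mxE sidx /= => ->.
Qed.

(** The nearest of -1, 0, 1 is within 1/2. The radius 3/4 exceeds 1/2 with a strict inequality,
    which gives an open cover, and leaves 1/4 for moving grid points into general position. *)
Lemma clamp_grid (R : realFieldType) (y : R) : -1 <= y <= 1 ->
  exists a : 'I_3, `|y - (a%:R - 1)| < 3 / 4.
Proof.
move=> /andP[y1 y2]; have [y3|y3] := ltP y (- (1 / 2)).
  by exists (@Ordinal 3 0 isT); rewrite ltr_norml; apply/andP; split => /=; lra.
have [y4|y4] := ltP y (1 / 2).
  by exists (@Ordinal 3 1 isT); rewrite ltr_norml; apply/andP; split => /=; lra.
by exists (@Ordinal 3 2 isT); rewrite ltr_norml; apply/andP; split => /=; lra.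
Qed.

Lemma lt_continuous_open (R : realType) (X : topologicalType) (f : X -> R) a :
  continuous f -> open [set x | f x < a].
Proof. by move=> fc; apply: (open_comp _ (@open_lt R a)) => x _; exact: fc. Qed.

(** Let [c] be [b] clamped to the cube, and [kap] the barycentric map of a fine cover into points in
    general position. Then [b + (kap - c)] works: where all [|b k| <= 1] it equals [kap], a
    combination of at most [d + 1 <= N] points; elsewhere some [|b k| > 1], and a change below 1
    cannot cancel it. *)
Lemma unit_perturbation (R : realType) (X : topologicalType) (d N : nat)
    (b : 'I_N -> X -> R) :
  normal_space X -> covering_dim_le X d -> (d < N)%N ->
  (forall k, continuous (b k)) ->
  exists b' : 'I_N -> X -> R,
    [/\ forall k, continuous (b' k), forall k x, `|b' k x - b k x| < 1
      & forall x, exists k, b' k x != 0].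
Proof.
move=> normalX dimX dN bc.
pose c k x : R := Num.max (-1) (Num.min 1 (b k x)).
have cc k : continuous (c k).
  move=> x; apply: (@continuous_max R X (fun=> -1)); first exact: cst_continuous.
  by apply: (@continuous_min R X (fun=> 1)); [exact: cst_continuous|exact: bc].
have c_itv k x : -1 <= c k x <= 1.
  by rewrite /c le_max lexx /= ge_max ge_min lexx /= andbT; lra.
have bE k x : `|b k x| <= 1 -> c k x = b k x.
  rewrite ler_norml => /andP[b1 b2].
  by rewrite /c (min_idPr _)// (max_idPr _).
pose q (i : {ffun 'I_N -> 'I_3}) (k : 'I_N) : R := (i k)%:R - 1.
pose U (i : {ffun 'I_N -> 'I_3}) := [set x | forall k, `|c k x - q i k| < 3 / 4].
have Uo i : open (U i).
  rewrite openE => x Ux; apply: filter_forall => k.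
  apply: open_nbhs_nbhs; split; last exact: Ux.
  apply: (@lt_continuous_open _ _ (fun x => `|c k x - q i k|) (3 / 4)) => y.
  apply: (@cvg_norm _ R^o); apply: (@cvgB _ R^o); first exact: cc.
  exact: cvg_cst.
have Uc : \bigcup_i U i = setT.
  rewrite -subTset => x _.
  have [a aP] := choice (fun k => clamp_grid (c_itv k x)).
  by exists (finfun a) => // k; rewrite /q ffunE.
have [V [Vo Vc VU Vd]] := finite_refinement dimX Uo Uc.
have [l [lc l0 lV lP]] := cozero_refinement R normalX Vo Vc.
(* The grid points come with [N] spare points, initially 0, that serve as padding in
   [sum_points_neq0]. *)
pose q' (t : {ffun 'I_N -> 'I_3} + 'I_N) : 'rV[R]_N :=
  \row_k (if t is inl i then q i k else 0).
have e0 : 0 < 1 / 4 :> R by lra.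
have [p [pq p_unit]] := general_position q' e0.
pose L x := \sum_i l i x.
have L0 x : 0 < L x.
  have [i li] := lP x; rewrite /L (bigD1 i)//= ltr_wpDr// sumr_ge0//.
pose kap k x := (\sum_i l i x * p (inl i) 0 k) / L x.
have kapc k : continuous (kap k).
  move=> x; apply: (@continuousM R X (fun x => \sum_i l i x * p (inl i) 0 k)
    (fun x => (L x)^-1)); last first.
    by apply: continuousV; [rewrite gt_eqF|exact: continuous_sum].
  apply: continuous_sum => i _ y; apply: continuousM; first exact: lc.
  exact: cvg_cst.
have kapB k x : `|kap k x - c k x| < 1.
  rewrite /kap -[c k x](mulfK (lt0r_neq0 (L0 x))) -mulrBl normrM normfV.
  rewrite (gtr0_norm (L0 x)) ltr_pdivrMr// mul1r [in X in _ - X]/L mulr_sumr.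
  rewrite -sumrB; apply: le_lt_trans (ler_norm_sum _ _ _) _.
  (* Where [l i] is positive, [c] is within 3/4 of the grid point, which was moved by less than
     1/4. *)
  have li_le i : l i x != 0 ->
      `|l i x * p (inl i) 0 k - c k x * l i x| < l i x.
    move=> li; have li0 : 0 < l i x by rewrite lt_neqAle eq_sym li l0.
    rewrite [c k x * _]mulrC -mulrBr normrM gtr0_norm//.
    rewrite gtr_pMr//; have := pq (inl i) k; rewrite mxE.
    have := VU _ _ (lV _ _ li0) k.
    rewrite !ltr_norml => /andP[? ?] /andP[? ?]; apply/andP; split; lra.
  have [i li] := lP x; rewrite /L (bigD1 i)//= [ltRHS](bigD1 i)//=.
  apply: ltr_leD; first by apply: li_le; rewrite gt_eqF.
  apply: ler_sum => j _; have [->|/li_le/ltW//] := eqVneq (l j x) 0.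
  by rewrite mul0r mulr0 subr0 normr0.
exists (fun k x => b k x + (kap k x - c k x)); split.
- move=> k x.
  apply: (@continuousD R R^o X (b k) (fun x => kap k x - c k x)).
    exact: bc.
  by apply: (@continuousB R R^o X (kap k) (c k)); [exact: kapc|exact: cc].
- by move=> k x; rewrite [X in `|X|]addrAC subrr add0r.
move=> x; have [bx|] := pselect (forall k, `|b k x| <= 1); last first.
  move/existsNP => [k /negP]; rewrite -ltNge => bk; exists k.
  apply: contraTN bk => /eqP bk0; rewrite -leNgt.
  have -> : b k x = - (kap k x - c k x).
    by apply/eqP; rewrite -addr_eq0; exact/eqP.
  by rewrite normrN ltW.
apply: contrapT => /forallNP kap0.
have : \sum_i l i x *: p (inl i) != 0.
  apply: sum_points_neq0 => //.
    by have [i li] := lP x; exists i; rewrite gt_eqF.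
  apply: leq_trans dN; apply: (Vd x) => i; rewrite inE => li.
  by apply: lV; rewrite lt_neqAle eq_sym li l0.
case/eqP; apply/rowP => k; rewrite summxE mxE.
have /negP := kap0 k; rewrite negbK bE// addrC subrK /kap mulf_eq0.
rewrite invr_eq0 (gt_eqF (L0 x)) orbF => /eqP s0.
by rewrite -[RHS]s0; apply: eq_bigr => i _; rewrite mxE.
Qed.

(** Division by [e] reduces this to the unit case for the coordinates in [P]; the others are left
    unchanged. *)
Lemma nonvanishing_perturbation (R : realType) (X : topologicalType)
    (d : nat) (J : finType) (P : pred J) (b : J -> X -> R) (e : X -> R) :
  normal_space X -> covering_dim_le X d -> (d < #|P|)%N ->
  (forall j, continuous (b j)) -> continuous e -> (forall x, 0 < e x) ->
  exists b' : J -> X -> R,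
    [/\ forall j, continuous (b' j), forall j x, `|b' j x - b j x| < e x
      & forall x, exists2 j, P j & b' j x != 0].
Proof.
move=> normalX dimX dP bc ec e0.
have bec (k : 'I_#|P|) : continuous (fun x => b (enum_val k) x / e x).
  move=> x; apply: (@continuousM R X (b (enum_val k)) (fun x => (e x)^-1)).
    exact: bc.
  by apply: continuousV; [rewrite gt_eqF|exact: ec].
have [c [cc cb c0]] := unit_perturbation normalX dimX dP bec.
(* The match supplies the proof of [P j] that [enum_rank_in] requires. *)
exists (fun j x => match @idP (P j) with
  | ReflectT Pj => e x * c (enum_rank_in Pj j) x | ReflectF _ => b j x end).
split.
- move=> j; case: {-}_ / idP => Pj; last exact: bc.
  by move=> x; apply: (@continuousM R X e (c _)); [exact: ec|exact: cc].
- move=> j x; case: {-}_ / idP => Pj; last by rewrite subrr normr0.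
  have := cb (enum_rank_in Pj j) x; rewrite enum_rankK_in//.
  set y := c _ x => cy.
  have -> : e x * y - b j x = e x * (y - b j x / e x).
    by field; exact: lt0r_neq0.
  by rewrite normrM (gtr0_norm (e0 x)) gtr_pMr.
- move=> x; have [k ck] := c0 x; exists (enum_val k); first exact: enum_valP.
  case: {-}_ / idP => [Pk|]; last by case/(_ (enum_valP k)).
  by rewrite enum_valK_in mulf_neq0// lt0r_neq0.
Qed.

(** * Unitaries sending a vector to the first axis *)

Lemma trmxC_mul (C : numClosedFieldType) (n p q : nat) (A : 'M[C]_(n, p))
    (B : 'M[C]_(p, q)) :
  (A *m B)^t* = B^t* *m A^t*.
Proof. by rewrite trmx_mul map_mxM. Qed.

Lemma trmxCK (C : numClosedFieldType) (n p : nat) (A : 'M[C]_(n, p)) :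
  (A^t*)^t* = A.
Proof. by apply/matrixP => i j; rewrite !mxE conjCK. Qed.

(** With [s = r (r - w_0)] one has [b^* w = s], so [H w = w - b], and [b^* b = s + s^*], which makes
    [H] unitary although [s] need not be real. Not correcting the phase of [w_0] keeps the formula
    continuous wherever [w_0 != r]. *)
Lemma householder (C : numClosedFieldType) (m : nat) (w : 'cV[C]_m.+1) (r : C) :
  let b := w - r *: delta_mx 0 0 in
  let H := 1%:M - (r * (r - w 0 0))^-1 *: (b *m b^t*) in
  r^* = r -> r != 0 -> r != w 0 0 -> w^t* *m w = (r ^+ 2)%:M ->
  H \is unitarymx /\ H *m w = r *: delta_mx 0 0.
Proof.
move=> b H rJ r0 rw ww; set s := r * (r - w 0 0).
have s0 : s != 0 by rewrite mulf_neq0// subr_eq0.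
have bJ : b^t* = w^t* - r *: delta_mx 0 0.
  apply/matrixP => i j; rewrite !mxE rmorphB rmorphM rmorph_nat /=.
  by rewrite rJ andbC.
have bw : b^t* *m w = s%:M.
  rewrite bJ mulmxBl ww -scalemxAl -rowE; apply/matrixP => i j.
  by rewrite !ord1 !mxE !mulr1n /s; ring.
have bb : b^t* *m b = (s + s^*)%:M.
  rewrite {2}/b mulmxBr bw -scalemxAr -colE bJ; apply/matrixP => i j.
  by rewrite !ord1 !mxE !eqxx !mulr1n /s rmorphM rmorphB/= rJ; ring.
split; last first.
  by rewrite /H mulmxBl mul1mx -scalemxAl -mulmxA bw mul_mx_scalar scalerA
    mulVf// scale1r /b opprB addrC subrK.
set B := b *m b^t* in H *.
have BJ : B^t* = B by rewrite trmxC_mul trmxCK.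
have HJ : H^t* = 1%:M - (s^*)^-1 *: B.
  by rewrite /H linearB/= trmx1 linearZ/= map_mxB map_mx1 map_mxZ fmorphV BJ.
apply/unitarymxP; rewrite HJ /H -/s.
have BB : B *m B = (s + s^*) *: B.
  by rewrite /B mulmxA -(mulmxA b) bb mul_mx_scalar -scalemxAl.
rewrite mulmxBl mul1mx -scalemxAl mulmxBr mulmx1 -scalemxAr BB scalerBr !scalerA.
rewrite -scalerBl -addrA -opprD -scalerDl [X in X *: B](_ : _ = 0).
  by rewrite scale0r subr0.
have : s^* != 0 by rewrite conjC_eq0.
by move: (s^*) => t t0; field; rewrite s0 t0.
Qed.

(** [V] is the inverse of [w / r] in the unit circle. *)
Lemma unitary_to_first_axis1 (C : numClosedFieldType) (w : 'cV[C]_1) (r : C) :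
  let V := r^-1 *: w^t* in
  r^* = r -> r != 0 -> w^t* *m w = (r ^+ 2)%:M ->
  V \is unitarymx /\ V *m w = r *: delta_mx 0 0.
Proof.
move=> V rJ r0 ww; split; last first.
  rewrite /V -scalemxAl ww; apply/matrixP => i j.
  by rewrite !ord1 !mxE !mulr1n mulr1; field.
apply/unitarymxP; rewrite {}/V; move/matrixP/(_ 0 0): ww.
rewrite !mxE big_ord1 !mxE mulr1n => ww; apply/matrixP => i j.
rewrite !ord1 mxE big_ord1 !mxE !mulr1n.
rewrite rmorphM fmorphV /= rJ conjCK mulrACA ww; by field.
Qed.

(** [V] is the adjoint of the element of SU(2) whose first column is [w / r]. *)
Lemma unitary_to_first_axis2 (C : numClosedFieldType) (w : 'cV[C]_2) (r : C) :
  let V := \matrix_(i < 2, j < 2)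
    ((if i == ord0 then (w j 0)^*
      else if j == ord0 then - w ord_max 0 else w ord0 0) / r) in
  r^* = r -> r != 0 -> w^t* *m w = (r ^+ 2)%:M ->
  V \is unitarymx /\ V *m w = r *: delta_mx 0 0.
Proof.
have lift00 : lift ord0 ord0 = ord_max :> 'I_2 by exact: val_inj.
have I2 (i : 'I_2) : i = ord0 \/ i = ord_max.
  by case: (unliftP ord0 i) => [k|] ->; [right; rewrite ord1|left].
have neq : (ord_max == ord0 :> 'I_2) = false by [].
move=> V rJ r0 /matrixP/(_ 0 0); rewrite !mxE !big_ord_recl big_ord0 !mxE.
rewrite {}/V lift00 mulr1n addr0.
move=> ww; split; last first.
  apply/matrixP => i j; rewrite ord1 !mxE !big_ord_recl big_ord0 !mxE lift00.
  case: (I2 i) => ->; rewrite ?eqxx ?neq /= ?mulr1n ?mulr0n.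
    rewrite addr0 mulr1 mulrAC [X in _ + X]mulrAC -mulrDl ww. by field.
  move: (w ord0 0) (w ord_max 0) => a b; by field.
apply/unitarymxP/matrixP => i j; rewrite !mxE !big_ord_recl big_ord0 !mxE lift00.
rewrite !rmorphM !fmorphV /= !rJ.
move: (w ord0 0) (w ord_max 0) ww => a b ww.
case: (I2 i) => ->; case: (I2 j) => ->;
  rewrite ?eqxx ?neq /= ?rmorphN /= ?conjCK addr0.
- by rewrite mulrACA [X in _ + X]mulrACA -mulrDl ww; field.
- by move: (a^*) (b^*) => a' b'; field.
- by field.
- rewrite !mulNr mulrN opprK addrC mulrACA [X in _ + X]mulrACA.
  by rewrite -mulrDl [a * _]mulrC [b * _]mulrC ww; field.
Qed.

Local Open Scope complex_scope.

(** * Continuity of complex matrices *)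

Section complex_continuity.
Context {R : realType} {X : topologicalType}.
Implicit Types f g : X -> R[i].

Lemma complex_ReIm_le (z : R[i]) (e : R) :
  `|z| < e%:C -> `|complex.Re z| < e /\ `|complex.Im z| < e.
Proof.
rewrite normc_def ltcR => ze; split; apply: le_lt_trans ze;
  by rewrite -sqrtr_sqr ler_wsqrtr// ?lerDl ?lerDr sqr_ge0.
Qed.

Lemma complex_lt_ReIm (z : R[i]) (e : R) :
  `|complex.Re z| < e / 2 -> `|complex.Im z| < e / 2 -> `|z| < e%:C.
Proof.
move=> re im; rewrite [z]complexE; apply: le_lt_trans (ler_normD _ _) _.
rewrite normrM !normc_def/= !expr0n/= !expr1n !addr0 add0r sqrtr1 mul1r.
rewrite !sqrtr_sqr -rmorphD ltcR; lra.
Qed.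

Lemma Re_continuous f : continuous f -> continuous (fun x => complex.Re (f x)).
Proof.
move=> fc x; apply/(@cvgrPdist_lt _ R^o) => e e0.
have /cvgrPdist_lt/(_ e%:C) := fc x; rewrite ltcR => /(_ e0).
by apply: filterS => y /complex_ReIm_le[+ _]; rewrite raddfB.
Qed.

Lemma Im_continuous f : continuous f -> continuous (fun x => complex.Im (f x)).
Proof.
move=> fc x; apply/(@cvgrPdist_lt _ R^o) => e e0.
have /cvgrPdist_lt/(_ e%:C) := fc x; rewrite ltcR => /(_ e0).
by apply: filterS => y /complex_ReIm_le[_ +]; rewrite raddfB.
Qed.

Lemma complex_continuous (a b : X -> R) :
  continuous a -> continuous b -> continuous (fun x => a x +i* b x).
Proof.
move=> ac bc x; apply/cvgrPdist_lt => -[e e'].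
rewrite ltcE /= => /andP[/eqP -> e0].
have e20 : 0 < e / 2 by rewrite divr_gt0.
have /(@cvgrPdist_lt _ R^o)/(_ _ e20) := ac x.
have /(@cvgrPdist_lt _ R^o)/(_ _ e20) := bc x.
apply: filterS2 => y im re; exact: complex_lt_ReIm.
Qed.

Lemma conj_continuous f : continuous f -> continuous (fun x => (f x)^*).
Proof.
move=> fc; rewrite (_ : (fun x => _) =
    fun x => complex.Re (f x) -i* complex.Im (f x)); last first.
  by apply/funext => x; case: (f x).
apply: complex_continuous; first exact: Re_continuous.
move=> x; apply: (@continuousN R R^o X (fun x => complex.Im (f x))).
exact: Im_continuous.
Qed.

Lemma mulmx_continuous (m n p : nat) (A : X -> 'M[R[i]]_(m, n))
    (B : X -> 'M[R[i]]_(n, p)) :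
  continuous A -> continuous B -> continuous (fun x => A x *m B x).
Proof.
move=> Ac Bc; apply: mx_continuousP => i j.
rewrite (_ : (fun x => _) = fun x => \sum_k A x i k * B x k j); last first.
  by apply/funext => x; rewrite mxE.
apply: continuous_sum => k _ x.
apply: (@continuousM _ _ (fun x => A x i k) (fun x => B x k j)).
  exact: mx_coord_continuous Ac _.
exact: mx_coord_continuous Bc _.
Qed.

Lemma addmx_continuous (m n : nat) (A B : X -> 'M[R[i]]_(m, n)) :
  continuous A -> continuous B -> continuous (fun x => A x + B x).
Proof.
move=> Ac Bc; apply: mx_continuousP => i j.
rewrite (_ : (fun x => _) = fun x => A x i j + B x i j); last first.
  by apply/funext => x; rewrite mxE.
move=> x; apply: (@continuousD _ R[i]^o _ (fun x => A x i j) (fun x => B x i j)).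
  exact: mx_coord_continuous Ac _.
exact: mx_coord_continuous Bc _.
Qed.

Lemma trmxC_continuous (m n : nat) (A : X -> 'M[R[i]]_(m, n)) :
  continuous A -> continuous (fun x => (A x)^t*).
Proof.
move=> Ac; apply: mx_continuousP => i j.
rewrite (_ : (fun x => _) = fun x => (A x j i)^*); last first.
  by apply/funext => x; rewrite !mxE.
exact/conj_continuous/mx_coord_continuous.
Qed.

Lemma block_mx_continuous (m1 m2 n1 n2 : nat) (A : X -> 'M[R[i]]_(m1, n1))
    (B : X -> 'M[R[i]]_(m1, n2)) (C : X -> 'M[R[i]]_(m2, n1))
    (D : X -> 'M[R[i]]_(m2, n2)) :
  continuous A -> continuous B -> continuous C -> continuous D ->
  continuous (fun x => block_mx (A x) (B x) (C x) (D x)).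
Proof.
move=> Ac Bc Cc Dc; apply: mx_continuousP => i j.
rewrite (_ : (fun x => _) = fun x => match fintype.split i, fintype.split j with
  | inl i', inl j' => A x i' j' | inl i', inr j' => B x i' j'
  | inr i', inl j' => C x i' j' | inr i', inr j' => D x i' j' end); last first.
  apply/funext => x; rewrite mxE.
  by case: (fintype.split i) => i'; rewrite mxE; case: (fintype.split j).
by case: (fintype.split i) => i'; case: (fintype.split j) => j';
  exact: mx_coord_continuous.
Qed.

End complex_continuity.

(** * Normalizing a perturbed vector *)

Section l2norm.
Context {R : realType}.

Lemma trmxC_mul_self (m : nat) (w : 'cV[R[i]]_m) :
  w^t* *m w = ((l2norm w)%:C ^+ 2)%:M.
Proof.
apply/matrixP => i j; rewrite !ord1 !mxE mulr1n -rmorphXn /l2norm sqr_sqrtr.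
  rewrite rmorph_sum; apply: eq_bigr => k _.
  by rewrite !mxE mulrC -sqr_normc rmorphXn.
by apply: sumr_ge0 => k _; exact: sqr_ge0.
Qed.

Lemma l2norm_continuous (X : topologicalType) (m : nat)
    (w : X -> 'cV[R[i]]_m) :
  continuous w -> continuous (fun x => l2norm (w x)).
Proof.
move=> wc; rewrite (_ : (fun x => _) =
    @Num.sqrt R \o (fun x => complex.Re (((w x)^t* *m w x) 0 0))).
  move=> x; apply: continuous_comp; last exact: sqrt_continuous.
  apply: Re_continuous; apply: mx_coord_continuous.
  by apply: mulmx_continuous => //; exact: trmxC_continuous.
apply/funext => x /=; rewrite trmxC_mul_self mxE mulr1n -rmorphXn /=.
by rewrite sqrtr_sqr ger0_norm// sqrtr_ge0.
Qed.

Lemma l2norm_gt0 (m : nat) (w : 'cV[R[i]]_m) i : w i 0 != 0 -> 0 < l2norm w.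
Proof.
move=> wi; rewrite sqrtr_gt0 (bigD1 i)//= ltr_wpDr//.
  by apply: sumr_ge0 => k _; exact: sqr_ge0.
rewrite exprn_even_gt0//=; apply: contra wi.
by move=> /eqP /ComplexField.Normc.eq0_normc ->.
Qed.

(** This is the case that the Householder formula must avoid: a coordinate carrying the whole norm
    leaves nothing for the others. *)
Lemma l2norm_eq_coord (m : nat) (w : 'cV[R[i]]_m) i :
  w i 0 = (l2norm w)%:C ->
  complex.Im (w i 0) = 0 /\ forall j, j != i -> w j 0 = 0.
Proof.
move=> wi; split=> [|j ji]; first by rewrite wi.
have : \sum_(k < m | k != i) ComplexField.Normc.normc (w k 0) ^+ 2 = 0.
  have : l2norm w ^+ 2 = \sum_(k < m) ComplexField.Normc.normc (w k 0) ^+ 2.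
    by rewrite sqr_sqrtr// sumr_ge0// => k _; exact: sqr_ge0.
  rewrite (bigD1 i)//= wi /ComplexField.Normc.normc /= expr0n addr0.
  rewrite sqr_sqrtr ?sqr_ge0//.
  by move/eqP; rewrite -subr_eq0 opprD addNKr oppr_eq0 => /eqP.
move/eqP; rewrite psumr_eq0 => [/allP/(_ j)|k _]; last exact: sqr_ge0.
rewrite mem_index_enum ji sqrf_eq0.
by move=> /(_ isT)/eqP/ComplexField.Normc.eq0_normc.
Qed.

End l2norm.

Section unitary_normalization.
Context {R : realType} {X : topologicalType} {d : nat}.
Context (normalX : normal_space X) (dimX : covering_dim_le X d).
Context {e : X -> R} (e_cont : continuous e) (e_gt0 : forall x, 0 < e x).

(** C^m is treated as R^(2m), with [(i, false)] and [(i, true)] indexing the real and imaginary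
    parts. Leaving an index out of [P] keeps [w'] off the corresponding real axis. *)
Lemma vector_perturbation (m : nat) (P : pred ('I_m * bool))
    (w : X -> 'cV[R[i]]_m) :
  (d < #|P|)%N -> continuous w ->
  exists w' : X -> 'cV[R[i]]_m,
    [/\ continuous w', forall x i, `|w' x i 0 - w x i 0| < (e x)%:C
      & forall x, exists2 p, P p &
          (if p.2 then complex.Im (w' x p.1 0) else complex.Re (w' x p.1 0))
          != 0].
Proof.
move=> dP wc.
pose b (p : 'I_m * bool) x : R :=
  if p.2 then complex.Im (w x p.1 0) else complex.Re (w x p.1 0).
have bc p : continuous (b p).
  by case: p => i []; [apply: Im_continuous|apply: Re_continuous];
    exact: mx_coord_continuous.
have e2c : continuous (fun x => e x / 2).
  move=> x; apply: (@continuousM R X e (fun=> 2^-1)); first exact: e_cont.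
  exact: cvg_cst.
have e20 x : 0 < e x / 2 by rewrite divr_gt0.
have [b' [b'c b'b b'0]] :=
  nonvanishing_perturbation normalX dimX dP bc e2c e20.
exists (fun x => \col_i (b' (i, false) x +i* b' (i, true) x)); split.
- apply: mx_continuousP => i j.
  rewrite (_ : (fun x => _) = fun x => b' (i, false) x +i* b' (i, true) x).
    exact: complex_continuous.
  by apply/funext => x; rewrite mxE.
- move=> x i; rewrite mxE; apply: complex_lt_ReIm.
    by rewrite raddfB/=; exact: (b'b (i, false)).
  by rewrite raddfB/=; exact: (b'b (i, true)).
- by move=> x; have [[i c] Pp b'p] := b'0 x; exists (i, c) => //; case: c Pp b'p;
    rewrite mxE.
Qed.

(* Over a space of dimension at most [2 m] the perturbed vector can be kept off
   the real line through the first axis, where the Householder reflection moving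
   it to that axis is not defined. The two other cases use that the unit
   spheres of C and C^2 are groups. *)
Lemma unitary_normalization (m : nat) (w : X -> 'cV[R[i]]_m.+1) :
  (d <= m.*2)%N || (m <= 1)%N && (d <= m.*2.+1)%N -> continuous w ->
  exists (w' : X -> 'cV[R[i]]_m.+1) (V : X -> 'M[R[i]]_m.+1) (r : X -> R),
    [/\ continuous w', continuous V,
        forall x i, `|w' x i 0 - w x i 0| < (e x)%:C,
        forall x, V x \is unitarymx
      & forall x, 0 < r x /\ V x *m w' x = (r x)%:C *: delta_mx 0 0].
Proof.
have lift2 (w' : X -> 'cV[R[i]]_m.+1) : continuous w' ->
    continuous (fun x => (l2norm (w' x))%:C).
  move=> w'c; apply: complex_continuous; first exact: l2norm_continuous.
  exact: cst_continuous.
have rJ (x : R) : Num.conj x%:C = x%:C by exact: conjc_real.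
move=> + wc; case: leqP => [dm _|md /= /andP[m1 dm]].
  (* Omitting the real part of the first coordinate leaves [2m + 1 > d] real coordinates. If [w'_0]
     equalled the norm, all of these would vanish. *)
  pose P := predC1 (0 : 'I_m.+1, false).
  have dP : (d < #|P|)%N.
    by have := cardC1 (0 : 'I_m.+1, false); rewrite card_prod card_ord card_bool;
      rewrite /P => ->; lia.
  have [w' [w'c w'w w'0]] := vector_perturbation dP wc.
  pose r x := l2norm (w' x).
  have r0 x : 0 < r x.
    have [[i c] _ w'i] := w'0 x; apply: (@l2norm_gt0 _ _ _ i).
    by apply: contraNneq w'i => /= ->; case: c.
  have rn0 x : (r x)%:C != 0 by rewrite gt_eqF// ltcR.
  have rw x : (r x)%:C != w' x 0 0.
    apply/eqP => /esym/l2norm_eq_coord[im0 w'j].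
    have [[i c] /= ic] := w'0 x; have [i0|/w'j ->] := eqVneq i 0; last first.
      by case: c {ic} => /=; rewrite eqxx.
    by move: ic; rewrite /P /= i0; case: c => //= _; rewrite im0 eqxx.
  pose b x := w' x - (r x)%:C *: delta_mx 0 0.
  have bc : continuous b.
    apply: mx_continuousP => i j.
    rewrite (_ : (fun x => _) = fun x => w' x i j -
        (r x)%:C * (delta_mx 0 0 : 'cV[R[i]]_m.+1) i j); last first.
      by apply/funext => x; rewrite !mxE.
    move=> x; apply: (@continuousB _ R[i]^o _ (fun x => w' x i j)
      (fun x => (r x)%:C * (delta_mx 0 0 : 'cV[R[i]]_m.+1) i j)).
      exact: mx_coord_continuous w'c _.
    apply: (@continuousM R[i] X (fun x => (r x)%:C) (fun=> _)).
      exact: lift2.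
    exact: cvg_cst.
  pose s x := (r x)%:C * ((r x)%:C - w' x 0 0).
  have s0 x : s x != 0.
    by rewrite mulf_neq0 ?subr_eq0//; rewrite gt_eqF// ltcR.
  have sc : continuous s.
    move=> x; apply: (@continuousM R[i] X (fun x => (r x)%:C)
      (fun x => (r x)%:C - w' x 0 0)); first exact: lift2.
    apply: (@continuousB _ R[i]^o _ (fun x => (r x)%:C) (fun x => w' x 0 0)).
      exact: lift2.
    exact: mx_coord_continuous w'c _.
  exists w', (fun x => 1%:M - (s x)^-1 *: (b x *m (b x)^t*)), r.
  split; [exact: w'c| |exact: w'w| |].
  - apply: mx_continuousP => i j.
    rewrite (_ : (fun x => _) = fun x => (1%:M : 'M[R[i]]_m.+1) i j -
        (s x)^-1 * (b x *m (b x)^t*) i j); last first.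
      by apply/funext => x; rewrite !mxE.
    move=> x; apply: (@continuousB _ R[i]^o _ (fun=> _)
      (fun x => (s x)^-1 * (b x *m (b x)^t*) i j)); first exact: cvg_cst.
    apply: (@continuousM R[i] X (fun x => (s x)^-1)
      (fun x => (b x *m (b x)^t*) i j)).
      by apply: continuousV; [exact: s0|exact: sc].
    apply: mx_coord_continuous; apply: mulmx_continuous => //.
    exact: trmxC_continuous.
  - by move=> x; have [] :=
      householder (rJ (r x)) (rn0 x) (rw x) (trmxC_mul_self (w' x)).
  - move=> x; split; first exact: r0.
    by have [] := householder (rJ (r x)) (rn0 x) (rw x) (trmxC_mul_self (w' x)).
(* For [m <= 1] every nonzero vector is admissible, so all [2m + 2] real coordinates count. *)
have dP : (d < #|{: 'I_m.+1 * bool}|)%N.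
  by rewrite card_prod card_ord card_bool; lia.
have [w' [w'c w'w w'0]] := vector_perturbation dP wc.
pose r x := l2norm (w' x).
have r0 x : 0 < r x.
  have [[i c] _ w'i] := w'0 x; apply: (@l2norm_gt0 _ _ _ i).
  by apply: contraNneq w'i => /= ->; case: c.
have rn0 x : (r x)%:C != 0 by rewrite gt_eqF// ltcR.
have rVc : continuous (fun x => (r x)%:C^-1).
  move=> x; apply: (@continuousV R[i] X (fun x => (r x)%:C)); first exact: rn0.
  exact: lift2.
have ww x : (w' x)^t* *m w' x = ((r x)%:C ^+ 2)%:M := trmxC_mul_self (w' x).
case: m m1 w {wc dm md dP w'0 lift2} w' w'c w'w r r0 rn0 ww rVc
  => [|[|//]] _ w w' w'c w'w r r0 rn0 ww rVc.
  exists w', (fun x => (r x)%:C^-1 *: (w' x)^t*), r.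
  split; [exact: w'c| |exact: w'w| |].
  - apply: mx_continuousP => i j.
    rewrite (_ : (fun x => _) = fun x => (r x)%:C^-1 * (w' x)^t* i j); last first.
      by apply/funext => x; rewrite mxE.
    move=> x; apply: (@continuousM R[i] X (fun x => (r x)%:C^-1)
      (fun x => (w' x)^t* i j)); first exact: rVc.
    by apply: mx_coord_continuous; exact: trmxC_continuous.
  - by move=> x; have [] :=
      unitary_to_first_axis1 (rJ (r x)) (rn0 x) (ww x).
  - move=> x; split; first exact: r0.
    by have [] :=
      unitary_to_first_axis1 (rJ (r x)) (rn0 x) (ww x).
pose v x (i j : 'I_2) := if i == ord0 then (w' x j 0)^*
  else if j == ord0 then - w' x ord_max 0 else w' x ord0 0.
exists w', (fun x => \matrix_(i < 2, j < 2) (v x i j / (r x)%:C)), r.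
split; [exact: w'c| |exact: w'w| |].
- apply: mx_continuousP => i j.
  rewrite (_ : (fun x => _) = fun x => v x i j * (r x)%:C^-1); last first.
    by apply/funext => x; rewrite mxE.
  move=> x; apply: (@continuousM R[i] X (fun x => v x i j)
    (fun x => (r x)%:C^-1)); last exact: rVc.
  rewrite /v; case: (i == ord0).
    by apply: conj_continuous; exact: mx_coord_continuous.
  case: (j == ord0); last exact: mx_coord_continuous w'c _.
  apply: (@continuousN _ R[i]^o _ (fun x => w' x ord_max 0)).
  exact: mx_coord_continuous w'c _.
- by move=> x; have [] :=
    unitary_to_first_axis2 (rJ (r x)) (rn0 x) (ww x).
- move=> x; split; first exact: r0.
  by have [] :=
    unitary_to_first_axis2 (rJ (r x)) (rn0 x) (ww x).
Qed.

End unitary_normalization.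

(** * Column by column reduction *)

Lemma unitarymx_coord_le1 (C : numClosedFieldType) (n : nat) (u : 'M[C]_n) i j :
  u \is unitarymx -> `|u i j| <= 1.
Proof.
move=> /unitarymxP/matrixP/(_ i i); rewrite !mxE eqxx mulr1n => ui.
rewrite -(@expr_le1 _ 2)// -ui (bigD1 j)//= !mxE -normCK lerDl.
by apply: sumr_ge0 => k _; rewrite !mxE mul_conjC_ge0.
Qed.

(** Entries of a unitary have modulus at most 1, so each of the two products costs a factor [n]. *)
Lemma unitary_conj_coord_le (C : numClosedFieldType) (n : nat)
    (u E : 'M[C]_n) (e : C) :
  u \is unitarymx -> (forall i j, `|E i j| <= e) ->
  forall i j, `|(u^t* *m E *m u) i j| <= (n * n)%:R * e.
Proof.
move=> uU Ee i j; rewrite mxE; apply: le_trans (ler_norm_sum _ _ _) _.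
have -> : (n * n)%:R * e = \sum_(k < n) n%:R * e.
  by rewrite sumr_const card_ord natrM -mulrA mulr_natl.
apply: ler_sum => k _; rewrite normrM -[leRHS]mulr1.
apply: ler_pM => //; last exact: unitarymx_coord_le1.
rewrite mxE; apply: le_trans (ler_norm_sum _ _ _) _.
have -> : n%:R * e = \sum_(k < n) e by rewrite sumr_const card_ord mulr_natl.
apply: ler_sum => l _; rewrite normrM -[leRHS]mul1r !mxE norm_conjC.
by apply: ler_pM => //; exact: unitarymx_coord_le1.
Qed.

Lemma opnorm_le (R : realType) (n : nat) (A : 'M[R[i]]_n) (e : R) :
  (forall i j, `|A i j| <= e%:C) -> opnorm A <= (n * n)%:R * e.
Proof.
move=> Ae; apply: ge_sup => [|_ [v /= v1 <-]].
  exists (l2norm (A *m 0)), 0 => //=.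
  rewrite /l2norm big1 ?sqrtr0// => i _.
  by rewrite mxE ComplexField.Normc.normc0 expr0n.
(* For [n = 0] there is no entry to give [0 <= e], but both sides are 0. *)
case: n A Ae v v1 => [|n] A Ae v v1.
  by rewrite /l2norm big_ord0 sqrtr0 mul0r lexx.
have e0 : 0 <= e by rewrite -lecR; exact: le_trans (normr_ge0 _) (Ae ord0 ord0).
have vj j : ComplexField.Normc.normc (v j 0) <= 1.
  apply: le_trans v1; rewrite -[leLHS]ger0_norm ?sqrtr_ge0//; last first.
    by case: (v j 0) => a b /=; exact: sqrtr_ge0.
  rewrite -sqrtr_sqr ler_wsqrtr// (bigD1 j)//= lerDl.
  by apply: sumr_ge0 => k _; exact: sqr_ge0.
have Avi i : ComplexField.Normc.normc ((A *m v) i 0) <= n.+1%:R * e.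
  rewrite -lecR; change (`|(A *m v) i 0| <= (n.+1%:R * e)%:C).
  rewrite mxE; apply: le_trans (ler_norm_sum _ _ _) _.
  have -> : (n.+1%:R * e)%:C = \sum_(k < n.+1) e%:C.
    by rewrite sumr_const card_ord mulr_natl rmorphMn.
  apply: ler_sum => k _; rewrite normrM -[leRHS]mulr1 ler_pM//.
  by rewrite (_ : 1 = 1%:C)// lecR.
have ne0 : 0 <= (n.+1 * n.+1)%:R * e by rewrite mulr_ge0.
rewrite -[leRHS]ger0_norm// -sqrtr_sqr ler_wsqrtr//.
apply: (@le_trans _ _ (\sum_(i < n.+1) (n.+1%:R * e) ^+ 2)).
  apply: ler_sum => i _; rewrite ler_sqr ?nnegrE ?mulr_ge0//.
  by case: ((A *m v) i 0) => a b /=; exact: sqrtr_ge0.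
rewrite sumr_const card_ord -[leLHS]mulr_natl !exprMn mulrA.
rewrite ler_wpM2r ?sqr_ge0//.
rewrite -!natrX -natrM ler_nat expnMn.
by rewrite leq_mul// expnS leq_pmulr// expn_gt0.
Qed.

(** * One step of the Hessenberg reduction *)

Section hessenberg_step.
Context {R : realType} {k m : nat}.
Context (h : 'M[R[i]]_(k.+1 + m.+1)) (w : 'cV[R[i]]_m.+1).
Context (V : 'M[R[i]]_m.+1) (r : R).

(** The last column of the lower left block is the subdiagonal part of the column to be reduced;
    only it is corrected. *)
Definition column_change : 'M[R[i]]_(m.+1, k.+1) :=
  (w - col ord_max (dlsubmx h)) *m delta_mx 0 ord_max.

(** The adjoint block that restores self-adjointness lies to the right of the first [k + 1] columns,
    where [Hmx k.+1] imposes nothing. *)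
Definition hermitian_change : 'M[R[i]]_(k.+1 + m.+1) :=
  block_mx 0 (column_change^t* ) column_change 0.

Lemma trmxC_block (n1 n2 p1 p2 : nat) (A : 'M[R[i]]_(n1, p1)) B C
    (D : 'M[R[i]]_(n2, p2)) :
  (block_mx A B C D)^t* = block_mx (A^t* ) (C^t* ) (B^t* ) (D^t* ).
Proof. by rewrite tr_block_mx map_block_mx. Qed.

Lemma trmxC0 (n p : nat) : (0 : 'M[R[i]]_(n, p))^t* = 0.
Proof. by rewrite trmx0 map_mx0. Qed.

Lemma trmxC1 (n : nat) : (1%:M : 'M[R[i]]_n)^t* = 1%:M.
Proof. by rewrite trmx1 map_mx1. Qed.

Lemma hermitian_changeJ : hermitian_change^t* = hermitian_change.
Proof. by rewrite trmxC_block !trmxC0 trmxCK. Qed.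

Lemma block_unitary : V \is unitarymx ->
  (block_mx 1%:M 0 0 V : 'M[R[i]]_(k.+1 + m.+1)) \is unitarymx.
Proof.
move=> /unitarymxP VV; apply/unitarymxP; rewrite trmxC_block trmxC1 !trmxC0.
rewrite mulmx_block VV !mulmx0 !mul0mx mul1mx !addr0 !add0r.
by rewrite -scalar_mx_block.
Qed.

(** Left multiplication by [U] changes only the lower rows, and right multiplication by its adjoint
    only the later columns. In the lower left block the first [k] columns are already zero, and the
    last becomes [V w], a positive multiple of the first basis vector. *)
Lemma Hmx_step :
  Hmx k h -> 0 < r -> V *m w = r%:C *: delta_mx 0 0 ->
  let U := block_mx 1%:M 0 0 V in
  Hmx k.+1 (U *m (h + hermitian_change) *m U^t*).
Proof.
move=> hH r0 Vw U.
have dlE : dlsubmx h = col ord_max (dlsubmx h) *m delta_mx 0 ord_max.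
  apply/matrixP => i j; rewrite !mxE big_ord1 !mxE eqxx /=.
  have [->|jk] := eqVneq j ord_max; first by rewrite mulr1.
  have jltk : (j < k)%N.
    rewrite ltn_neqAle -ltnS ltn_ord andbT.
    by apply: contra jk => /eqP jk; apply/eqP/val_inj.
  rewrite mulr0; have [+ _] := hH (rshift k.+1 i) (lshift m.+1 j) jltk.
  by apply => /=; lia.
have -> : U *m (h + hermitian_change) *m U^t* =
    block_mx (ulsubmx h) ((ursubmx h + column_change^t* ) *m V^t* )
      (r%:C *: ((delta_mx 0 0 : 'cV_m.+1) *m delta_mx 0 ord_max))
      (V *m drsubmx h *m V^t* ).
  rewrite trmxC_block trmxC1 !trmxC0 -{1}[h]submxK add_block_mx.
  rewrite !mulmx_block !mulmx0 !mul0mx !mul1mx !mulmx1 !addr0 !add0r.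
  congr block_mx.
  by rewrite {1}dlE /column_change -mulmxDl addrC subrK mulmxA Vw scalemxAl.
move=> i j; case: (split_ordP j) => j' -> jk; last first.
  by move: jk; rewrite /= ltz_nat; lia.
case: (split_ordP i) => i' ->.
  rewrite block_mxEul !mxE; split=> /= ij.
    have [jlt|] := ltnP j' k.
      by have [+ _] := hH (lshift m.+1 i') (lshift m.+1 j') jlt; exact.
    (* In column [k], counted from 0, both conditions concern rows beyond the upper block. *)
    by have := ltn_ord i'; lia.
  have jlt : (j' < k)%N by have := ltn_ord i'; lia.
  by have [_ +] := hH (lshift m.+1 i') (lshift m.+1 j') jlt; exact.
rewrite block_mxEdl mul_delta_mx !mxE /=; split=> ij.
  have [/eqP i0|_] := boolP (i' == 0); last by rewrite mulr0.
  have [/eqP jm|_] := boolP (j' == ord_max); last by rewrite mulr0.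
  by move: ij; rewrite i0 jm /=; lia.
have [i0 jm] : i' = 0 /\ j' = ord_max.
  by have := ltn_ord j'; split; apply: val_inj => /=; lia.
by rewrite i0 jm !eqxx mulr1 ltcR.
Qed.

End hessenberg_step.

Lemma hermitian_change_le (R : realType) (k m : nat)
    (h : 'M[R[i]]_(k.+1 + m.+1)) (w : 'cV[R[i]]_m.+1) (e : R[i]) : 0 <= e ->
  (forall i, `|w i 0 - dlsubmx h i ord_max| <= e) ->
  forall i j, `|hermitian_change h w i j| <= e.
Proof.
move=> e0 we.
have De i j : `|column_change h w i j| <= e.
  rewrite mxE big_ord1 !mxE eqxx /=; case: (j == ord_max).
    by rewrite mulr1; move: (we i); rewrite !mxE.
  by rewrite mulr0 normr0.
move=> i j; rewrite /hermitian_change.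
case: (split_ordP i) => i' ->; case: (split_ordP j) => j' ->.
- by rewrite block_mxEul mxE normr0.
- by rewrite block_mxEur mxE mxE norm_conjC De.
- by rewrite block_mxEdl De.
- by rewrite block_mxEdr mxE normr0.
Qed.

(** * Iteration over the columns *)

Section reduction.
Context {R : realType} {X : topologicalType} {d : nat}.
Context (normalX : normal_space X) (dimX : covering_dim_le X d).

(** The change [E] of [h = u g u^*] is pulled back to the change [u^* E u] of [g], again
    self-adjoint, and [u] becomes [U u]. Conjugation can enlarge entries by [n * n], hence the
    tolerance [e / (n * n)]. The size is tied to [k] and [m] by an equation because it stays fixed
    while they vary. *)
Lemma column_step (n k m : nat) (g u : X -> 'M[R[i]]_n) (e : X -> R) :
  n = (k.+1 + m.+1)%N ->
  (d <= m.*2)%N || (m <= 1)%N && (d <= m.*2.+1)%N ->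
  continuous e -> (forall x, 0 < e x) -> continuous g -> continuous u ->
  (forall x, u x \is unitarymx) ->
  (forall x, Hmx k (u x *m g x *m (u x)^t* )) ->
  exists g' u' : X -> 'M[R[i]]_n,
    [/\ continuous g', continuous u', forall x, u' x \is unitarymx,
        forall x, (g' x - g x)^t* = g' x - g x
      & (forall x i j, `|(g' x - g x) i j| <= (e x)%:C) /\
        forall x, Hmx k.+1 (u' x *m g' x *m (u' x)^t* )].
Proof.
move=> nE; subst n; set n := (k.+1 + m.+1)%N in g u * => dm ec e0 gc uc uU hH.
pose h x := u x *m g x *m (u x)^t*.
have usc : continuous (fun x => (u x)^t* ) by exact: trmxC_continuous.
have hc : continuous h := mulmx_continuous (mulmx_continuous uc gc) usc.
pose w x := col ord_max (dlsubmx (h x)).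
have wc : continuous w.
  apply: mx_continuousP => i j.
  rewrite (_ : (fun x => _) =
      fun x => h x (rshift k.+1 i) (lshift m.+1 ord_max)).
    exact: mx_coord_continuous.
  by apply/funext => x; rewrite !mxE.
have N0 : 0 < (n * n)%:R :> R by rewrite ltr0n.
have e'c : continuous (fun x => e x / (n * n)%:R).
  move=> x; apply: (@continuousM R X e (fun=> _)); first exact: ec.
  exact: cvg_cst.
have e'0 x : 0 < e x / (n * n)%:R by rewrite divr_gt0.
have [w' [V [r [w'c Vc w'w VU Vw']]]] :=
  unitary_normalization normalX dimX e'c e'0 dm wc.
pose E x := hermitian_change (h x) (w' x).
pose U x : 'M[R[i]]_n := block_mx 1%:M 0 0 (V x).
have Dc : continuous (fun x => column_change (h x) (w' x)).
  apply: mulmx_continuous; last exact: cst_continuous.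
  apply: mx_continuousP => i j.
  rewrite (_ : (fun x => _) = fun x => w' x i j - w x i j); last first.
    by apply/funext => x; rewrite !mxE.
  move=> x; apply: (@continuousB _ R[i]^o _ (fun x => w' x i j)
    (fun x => w x i j)); first exact: mx_coord_continuous w'c _.
  exact: mx_coord_continuous wc _.
have Ec : continuous E.
  apply: (@block_mx_continuous R X _ _ _ _ (fun=> 0)
    (fun x => (column_change (h x) (w' x))^t* )
    (fun x => column_change (h x) (w' x)) (fun=> 0)).
  - exact: cst_continuous.
  - exact: trmxC_continuous Dc.
  - exact: Dc.
  - exact: cst_continuous.
have Uc : continuous U.
  apply: (@block_mx_continuous R X _ _ _ _ (fun=> 1%:M) (fun=> 0) (fun=> 0) V).
  - exact: cst_continuous.
  - exact: cst_continuous.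
  - exact: cst_continuous.
  - exact: Vc.
have Eu x : g x + (u x)^t* *m E x *m u x - g x = (u x)^t* *m E x *m u x.
  by rewrite addrAC subrr add0r.
exists (fun x => g x + (u x)^t* *m E x *m u x), (fun x => U x *m u x).
split.
- exact: (addmx_continuous gc (mulmx_continuous (mulmx_continuous usc Ec) uc)).
- exact: (mulmx_continuous Uc uc).
- by move=> x; rewrite mul_unitarymx ?uU//; exact: block_unitary.
- by move=> x; rewrite Eu !trmxC_mul trmxCK hermitian_changeJ mulmxA.
split=> [x i j|x]; rewrite ?Eu.
  have -> : (e x)%:C = (n * n)%:R * (e x / (n * n)%:R)%:C.
    rewrite -(rmorph_nat (real_complex R)) -rmorphM mulrCA.
    by rewrite divff ?mulr1// gt_eqF.
  apply: unitary_conj_coord_le => // {}i {}j; apply: hermitian_change_le.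
    by rewrite ler0c ltW.
  by move=> i'; have := w'w x i'; rewrite !mxE => /ltW.
have [r0 Vw] := Vw' x.
have -> : U x *m u x *m (g x + (u x)^t* *m E x *m u x) *m (U x *m u x)^t* =
    U x *m (h x + E x) *m (U x)^t*.
  have /unitarymxP uu := uU x.
  rewrite trmxC_mul /h !mulmxDr !mulmxDl !mulmxA.
  by rewrite -!(mulmxA _ (u x) ((u x)^t* )) uu !mulmx1.
exact: Hmx_step (hH x) r0 Vw.
Qed.

Lemma hermitian_addJ (n : nat) (A B : 'M[R[i]]_n) :
  A^t* = A -> B^t* = B -> (A + B)^t* = A + B.
Proof. by move=> hA hB; rewrite linearD/= map_mxD hA hB. Qed.

(** By induction on [k]: half the tolerance goes to the earlier columns, half to the new one. The
    bound [k + c <= n] ensures that each column treated has at least [c] entries below the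
    diagonal. *)
Lemma hessenberg_approximation (n c k : nat) (f : X -> 'M[R[i]]_n) :
  (forall m, c <= m.+1 ->
    (d <= m.*2) || (m <= 1) && (d <= m.*2.+1))%N ->
  (k + c <= n)%N -> continuous f ->
  forall e : X -> R, continuous e -> (forall x, 0 < e x) ->
  exists g u : X -> 'M[R[i]]_n,
    [/\ continuous g, continuous u, forall x, u x \is unitarymx,
        forall x, (g x - f x)^t* = g x - f x
      & (forall x i j, `|(g x - f x) i j| <= (e x)%:C) /\
        forall x, Hmx k (u x *m g x *m (u x)^t* )].
Proof.
move=> hc + fc; elim: k => [_|k IH kn] e ec e0.
  exists f, (fun=> 1%:M); split; [exact: fc|exact: cst_continuous| | |].
  - by move=> x; apply/unitarymxP; rewrite trmxC1 mulmx1.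
  - by move=> x; rewrite subrr trmxC0.
  split=> [x i j|x i j]; last by rewrite ltz_nat.
  by rewrite subrr mxE normr0 ler0c ltW.
have e2c : continuous (fun x => e x / 2).
  move=> x; apply: (@continuousM R X e (fun=> _)); first exact: ec.
  exact: cvg_cst.
have e20 x : 0 < e x / 2 by rewrite divr_gt0.
have kn' : (k + c <= n)%N by lia.
have [g [u [gc uc uU gf [ge gH]]]] := IH kn' _ e2c e20.
(* The last column has nothing below the diagonal, so the matrices already obtained serve again. *)
have [nk|kn1] := leqP n k.+1.
  exists g, u; split; [exact: gc|exact: uc|exact: uU|exact: gf|split=> x i j].
    apply: le_trans (ge x i j) _; rewrite lecR ler_pdivrMr//.
    by have := e0 x; lra.
  rewrite ltz_nat => jk; have := gH x i j; rewrite ltz_nat.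
  have [jltk /(_ isT)//|kj _] := ltnP j k.
  by have := ltn_ord i; split; lia.
have nE : n = (k.+1 + (n - k.+2).+1)%N by lia.
have [|g' [u' [g'c u'c u'U g'g [g'e g'H]]]] :=
  column_step nE _ e2c e20 gc uc uU gH.
  by apply: hc; lia.
have gg x : g' x - f x = (g' x - g x) + (g x - f x) by rewrite addrA subrK.
exists g', u'; split; [exact: g'c|exact: u'c|exact: u'U| |].
  by move=> x; rewrite gg; exact: hermitian_addJ.
split=> [x i j|]; last exact: g'H.
rewrite gg mxE; apply: le_trans (ler_normD _ _) _.
rewrite [e x](splitr) rmorphD /=; exact: lerD.
Qed.

End reduction.

(** The circle ([m = 0]) covers [d <= 1] and the 3-sphere ([m = 1]) covers [d <= 3], which explains
    the small values of the bound. For [d >= 4] the hypothesis reads [uphalf d <= m], that is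
    [d <= 2m]. *)
Lemma codim_boundP (d m : nat) : (codim_bound d <= m.+1 ->
  (d <= m.*2) || (m <= 1) && (d <= m.*2.+1))%N.
Proof.
rewrite /codim_bound; have [d1|d1] := leqP d 1.
  by case: m => [|[|m]] _; lia.
have [d3|d3] := leqP d 3; first by case: m => [|[|m]]; lia.
by rewrite ltnS uphalf_half; have := odd_double_half d; lia.
Qed.

Theorem theorem3p1 (R : realType) (d : nat) (X : topologicalType)
    (normalX : normal_space X) (dimX : covering_dim_eq X d)
    (n : nat) (n_ge1 : (1 <= n)%N)
    (f : X -> 'M[R[i]]_n) (f_cont : continuous f)
    (eps : X -> R) (eps_cont : continuous eps) (eps_gt0 : forall x, 0 < eps x) :
  exists (g u : X -> 'M[R[i]]_n),
    [/\ continuous g, continuous u, forall x, u x \is unitarymx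
      & forall x,
        [/\ g x - f x \is hermsymmx,
            opnorm (f x - g x) < eps x
          & Hmx (n%:Z - (codim_bound d)%:Z) (u x *m g x *m (u x)^t*)]].
Proof.
(* Entries at most [eps / N] give operator norm at most [n * n * eps / N]; the successor in [N]
   makes this strictly less than [eps]. *)
pose N : R := (n * n).+1%:R.
have N0 : 0 < N by rewrite ltr0n.
have ec : continuous (fun x => eps x / N).
  move=> x; apply: (@continuousM R X eps (fun=> _)); first exact: eps_cont.
  exact: cvg_cst.
have e0 x : 0 < eps x / N by rewrite divr_gt0.
pose c := codim_bound d.
suff [g [u [gc uc uU gf [ge gH]]]] : exists g u : X -> 'M[R[i]]_n,
    [/\ continuous g, continuous u, forall x, u x \is unitarymx,
        forall x, (g x - f x)^t* = g x - f x
      & (forall x i j, `|(g x - f x) i j| <= (eps x / N)%:C) /\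
        forall x, Hmx (n%:Z - c%:Z) (u x *m g x *m (u x)^t* )].
  exists g, u; split; [exact: gc|exact: uc|exact: uU|].
  move=> x; split; last exact: gH.
    by apply/is_hermitianmxP; rewrite expr0 scale1r gf.
  apply: le_lt_trans (_ : (n * n)%:R * (eps x / N) < eps x).
    apply: opnorm_le => i j; rewrite -opprB mxE normrN; exact: ge.
  rewrite mulrCA gtr_pMr// ltr_pdivrMr// mul1r ltr_nat//.
have [cn|nc] := leqP c n.
  have kn : (n - c + c <= n)%N by rewrite subnK.
  have [g [u [gc uc uU gf [ge gH]]]] := hessenberg_approximation normalX
    (proj1 dimX) (@codim_boundP d) kn f_cont ec e0.
  exists g, u; split; [exact: gc|exact: uc|exact: uU|exact: gf|].
  by split=> [|x]; [exact: ge|rewrite subzn].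
(* Here [n - c] is negative, so the Hessenberg condition is vacuous. *)
exists f, (fun=> 1%:M); split; [exact: f_cont|exact: cst_continuous| | |].
- by move=> x; apply/unitarymxP; rewrite trmxC1 mulmx1.
- by move=> x; rewrite subrr trmxC0.
split=> [x i j|x i j]; last by move=> jk; exfalso; lia.
by rewrite subrr mxE normr0 ler0c ltW.
Qed.
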